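(* Let $1\to\Delta\to\Gamma\xrightarrow{\pi}\Lambda\to1$ be an exact sequence of countable groups and let $(N_i)_{i\in\mathbb N}$ be a sequence of finite index normal subgroups of $\Gamma$, with $N_{i+1}\subset N_i$ for all $i$, which separates $\Delta/(\bigcap_i(N_i\cap\Delta))$ from $\Gamma/(\bigcap_iN_i)$. If $\operatorname{asdim}\Box_{(N_i\cap\Delta)}\Delta=m$ and $\operatorname{asdim}\Box_{(\pi(N_i))}\Lambda=n$, then $\operatorname{asdim}\Box_{(N_i)}\Gamma\le m+n$.
   Context: Separation: given a subgroup $\Delta<\Gamma$ and a countable collection $(N_i)$ of finite index normal subgroups of $\Gamma$ directed by inclusion, $(N_i)$ separates $\Delta$ from $\Gamma$ if for every $\gamma\in\Gamma\setminus\Delta$ there is $i$ with $\gamma N_i\notin\{\delta N_i\mid\delta\in\Delta\}$. Saying that $(N_i)$ separates $\Delta/(\bigcap_i(N_i\cap\Delta))$ from $\Gamma/(\bigcap_iN_i)$ means that the images of the $N_i$ in $\Gamma/(\bigcap_iN_i)$ separate the image of $\Delta$ (isomorphic to $\Delta/(\bigcap_i(N_i\cap\Delta))$) from $\Gamma/(\bigcap_iN_i)$. Asymptotic dimension: for a metric space $X$, an $r$-chain in $U\subset X$ is a finite sequence $x_0,\dots,x_n\in U$ with $d(x_i,x_{i+1})\le r$; $r$-components of $U$ are the classes of points of $U$ connected by $r$-chains in $U$. $\operatorname{asdim}X\le d$ means that for all $r>0$ there are $M>0$ and a cover $\{U_0,\dots,U_d\}$ of $X$ such that every $r$-component of every $U_j$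 has diameter at most $M$. $\operatorname{asdim}X$ is the least such integer $d\geq 0$ ($\infty$ if none). Box space: each countable group $G$ carries a fixed right-invariant proper metric $d_G$ (balls are finite; such a metric is unique up to coarse equivalence). For finite index subgroups $(H_i)$ of $G$, $G/H_i$ has the metric in which the distance between two cosets is the infimum of the $d_G$-distances between their elements. $\Box_{(H_i)}G$ is the disjoint union of the $G/H_i$ with $d(x,y)=d_{G/H_i}(x,y)$ if $x,y\in G/H_i$ and $d(x,y)=\operatorname{diam}(G/H_i)+\operatorname{diam}(G/H_j)$ if $x\in G/H_i$, $y\in G/H_j$, $i\ne j$. *)

(* Defs.v *)
From HB Require Import structures.
From mathcomp Require Import all_boot all_order all_algebra.
From mathcomp Require Import all_classical all_reals ereal.

Set Implicit Arguments.
Unset Strict Implicit.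
Unset Printing Implicit Defensive.

Import Order.TTheory.

Local Open Scope classical_set_scope.
Local Open Scope group_scope.

Section Groups.
Variable G : groupType.
Implicit Types (g h : G) (H : set G).

Definition left_coset g H : set G := [set g * h | h in H].

Definition left_cosets H : set (set G) := range (fun g => left_coset g H).

Definition coset_space H : Type := left_cosets H.

HB.instance Definition _ H := Choice.on (coset_space H).

Definition coset_map H g : coset_space H :=
  exist _ (left_coset g H) (mem_set (imageT (fun g => left_coset g H) g)).

Definition finite_index H := finite_set (left_cosets H).

Record normal_subgroup := NormalSubgroup {
  normal_set :> set G;
  nsubg1 : normal_set 1;
  nsubgM : forall g h, normal_set g -> normal_set h -> normal_set (g * h);
  nsubgV : forall g, normal_set g -> normal_set g^-1;
  nsubgJ : forall g h, normal_set g -> normal_set (g ^ h) }.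

Definition bigcap_normal (I : Type) (N : I -> normal_subgroup) :
  normal_subgroup.
Proof.
exists (\bigcap_i N i).
- by move=> i _; apply: nsubg1.
- by move=> g h Ng Nh i _; apply: nsubgM; [apply: Ng|apply: Nh].
- by move=> g Ng i _; apply: nsubgV; apply: Ng.
- by move=> g h Ng i _; apply: nsubgJ; apply: Ng.
Defined.

Definition separates (N : nat -> set G) (D : set G) :=
  forall g, ~ D g ->
    exists i, ~ [set left_coset d (N i) | d in D] (left_coset g (N i)).

End Groups.

Section QuotientGroup.
Variables (G : groupType) (K : normal_subgroup G).

Definition quotient_group : Type := coset_space K.

HB.instance Definition _ := Choice.on quotient_group.

Definition quotient_map : G -> quotient_group := @coset_map G K.

Lemma quotient_mapP (A : quotient_group) : exists g, A = quotient_map g.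
Proof.
case: A => A HA; have [g _ gA] := set_mem HA.
by exists g; apply/val_inj; rewrite /= -gA.
Qed.

Lemma left_cosetM g h :
  [set x * y | x in left_coset g K & y in left_coset h K] =
  left_coset (g * h) K.
Proof.
apply/seteqP; split => [_ [_ [k Kk <-]] [_ [l Kl <-]] <-|_ [k Kk <-]].
  exists (k ^ h * l); first by apply: nsubgM => //; apply: nsubgJ.
  by rewrite /conjg !mulgA mulgK.
exists g; first by exists 1; [exact: nsubg1|rewrite mulg1].
by exists (h * k); [exists k|rewrite mulgA].
Qed.

Lemma left_cosetV g : [set x^-1 | x in left_coset g K] = left_coset g^-1 K.
Proof.
apply/seteqP; split => [_ [_ [k Kk <-] <-]|_ [k Kk <-]].
  exists (k^-1 ^ g^-1); first exact/nsubgJ/nsubgV.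
  by rewrite /conjg invgK invgM !mulgA mulVg mul1g.
exists (g * k^-1 ^ g); last by rewrite /conjg (mulgA g) mulgV mul1g invgM invgK.
by exists (k^-1 ^ g) => //; exact/nsubgJ/nsubgV.
Qed.

Lemma quotient_mul_subproof (A B : quotient_group) :
  [set x * y | x in val A & y in val B] \in left_cosets K.
Proof.
have [g ->] := quotient_mapP A; have [h ->] := quotient_mapP B.
by rewrite /= left_cosetM; apply: mem_set; exists (g * h).
Qed.

Lemma quotient_inv_subproof (A : quotient_group) :
  [set x^-1 | x in val A] \in left_cosets K.
Proof.
have [g ->] := quotient_mapP A.
by rewrite /= left_cosetV; apply: mem_set; exists g^-1.
Qed.

Definition quotient_one : quotient_group := quotient_map 1.
Definition quotient_mul (A B : quotient_group) : quotient_group :=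
  exist (fun C => C \in left_cosets K) _ (quotient_mul_subproof A B).
Definition quotient_inv (A : quotient_group) : quotient_group :=
  exist (fun C => C \in left_cosets K) _ (quotient_inv_subproof A).

Lemma quotient_mapM g h :
  quotient_map (g * h) = quotient_mul (quotient_map g) (quotient_map h).
Proof. by apply/val_inj; rewrite /= left_cosetM. Qed.

Lemma quotient_mapV g : quotient_map g^-1 = quotient_inv (quotient_map g).
Proof. by apply/val_inj; rewrite /= left_cosetV. Qed.

Lemma quotient_mulA : associative quotient_mul.
Proof.
move=> A B C; have [a ->] := quotient_mapP A; have [b ->] := quotient_mapP B.
by have [c ->] := quotient_mapP C; rewrite -!quotient_mapM mulgA.
Qed.

Lemma quotient_mul1g : left_id quotient_one quotient_mul.
Proof. by move=> A; have [a ->] := quotient_mapP A; rewrite -quotient_mapM mul1g. Qed.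

Lemma quotient_mulg1 : right_id quotient_one quotient_mul.
Proof. by move=> A; have [a ->] := quotient_mapP A; rewrite -quotient_mapM mulg1. Qed.

Lemma quotient_mulVg : left_inverse quotient_one quotient_inv quotient_mul.
Proof.
move=> A; have [a ->] := quotient_mapP A.
by rewrite -quotient_mapV -quotient_mapM mulVg.
Qed.

Lemma quotient_mulgV : right_inverse quotient_one quotient_inv quotient_mul.
Proof.
move=> A; have [a ->] := quotient_mapP A.
by rewrite -quotient_mapV -quotient_mapM mulgV.
Qed.

HB.instance Definition _ := isGroup.Build quotient_group
  quotient_mulA quotient_mul1g quotient_mulg1 quotient_mulVg quotient_mulgV.

HB.instance Definition _ :=
  isMultiplicative.Build G quotient_group quotient_map quotient_mapM.

End QuotientGroup.

Local Open Scope ring_scope.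

Section CoarseGeometry.
Variables (R : realType) (T : choiceType) (d : T -> T -> R).
Implicit Types (U : set T) (x y : T).

Record is_metric := IsMetric {
  dist_eq0 : forall x y, d x y = 0 <-> x = y;
  dist_sym : forall x y, d x y = d y x;
  dist_triangle : forall x y z, d x z <= d x y + d y z }.

Definition diam U : \bar R := ereal_sup [set (d x y)%:E | x in U & y in U].

Definition r_component (r : R) U x : set T :=
  [set y | exists s : seq T,
    [/\ path (fun a b => d a b <= r) x s, last x s = y
      & forall z, z \in x :: s -> U z]].

Definition asdim_le (n : nat) :=
  forall r : R, 0 < r -> exists M : R, 0 < M /\
    exists U : 'I_n.+1 -> set T, \bigcup_j U j = [set: T] /\
      forall j x, U j x -> (diam (r_component r (U j) x) <= M%:E)%E.

(* The values are natural numbers or +oo; [\bar int] rather than [\bar nat]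
   because the order of [\bar T] requires a numDomainType. *)
Definition asdim : \bar int :=
  if pselect (exists n, `[< asdim_le n >]) is left ex_n
  then (ex_minn ex_n)%:Z%:E else +oo%E.

End CoarseGeometry.

Definition proper_right_invariant_metric (R : realType) (G : groupType)
    (d : G -> G -> R) :=
  [/\ is_metric d,
      forall x y g : G, d (x * g)%g (y * g)%g = d x y
    & forall (x : G) (r : R), finite_set [set y | d x y <= r]].

Section BoxSpace.
Variables (R : realType) (G : groupType) (d : G -> G -> R).

Definition set_dist (A B : set G) : R := inf [set d x y | x in A & y in B].

Definition coset_dist (H : set G) (A B : coset_space H) : R :=
  set_dist (val A) (val B).

Definition box_space (H : nat -> set G) : choiceType :=
  {i : nat & coset_space (H i)}.

(* The diameters are finite when the [H i] have finite index. Distinct points in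
   components of diameter 0 are at distance 0, so that this is in general only a
   pseudometric. *)
Definition box_dist (H : nat -> set G) (x y : box_space H) : R :=
  if tag x == tag y then set_dist (val (tagged x)) (val (tagged y))
  else fine (diam (@coset_dist (H (tag x))) setT)
     + fine (diam (@coset_dist (H (tag y))) setT).

End BoxSpace.

(* Main.v *)
(** Let E_r be the relation "same index i, and distance at most r modulo N_i" on
    nat * Gamma. A box space has asymptotic dimension at most n if and only if
    this group-level structure does, because the components of diameter at most
    r of the box space together form a bounded set. So it suffices to prove a
    Hurewicz theorem for a bornologous map f : X -> Y.

    Cover Y by U_0, ..., U_n with bounded components at a large scale, and
    colour the preimages of U_0, ..., U_j with m + j + 1 colours by induction on
    j. Each component of U_j has a preimage that can be coloured with m + 1
    colours at a scale much larger than the bounds of the colours V_c already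
    obtained, hence compatibly with them near that component. Moving away from
    U_j, each of the colours 0, ..., m is left empty for a while, so that the
    V_c can be moved one colour down, V_0 receiving the only new colour; this
    disconnects the components of U_j from each other.

    For Gamma -> Lambda the preimage of a bounded set lies near a translate of
    Delta. Separation, with the finiteness of balls, shows that the two
    structures on Delta, from Delta modulo its intersections with the N_i and
    from Gamma modulo the N_i, are coarsely equivalent uniformly in i. *)
Require Import Defs.
From mathcomp Require Import all_boot all_order all_algebra.
From mathcomp Require Import all_classical all_reals ereal lra ring zify.
Set Implicit Arguments.
Unset Strict Implicit.
Unset Printing Implicit Defensive.
Import Order.TTheory GRing.Theory Num.Theory.
Local Open Scope classical_set_scope.
Local Open Scope ring_scope.

(** * Relations graded by scale, and coverings with bounded components *)

Section ScaleRelations.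
Context {R : realType}.

(** [E r x y] stands for a distance at most [r]; two points may be unrelated at every scale. *)
Record scale_rel (T : Type) (E : R -> T -> T -> Prop) : Prop := ScaleRel {
  scale_refl : forall r x, 0 <= r -> E r x x;
  scale_sym : forall r x y, E r x y -> E r y x;
  scale_trans : forall r s x y z, E r x y -> E s y z -> E (r + s) x z;
  scale_mono : forall r s x y, r <= s -> E r x y -> E s x y }.

(* [l] takes constant values on the r-components of [U], but may also merge
   several of them. *)
Definition components_le (T : Type) (E : R -> T -> T -> Prop) (r M : R)
    (U : set T) := exists l : T -> set T,
  (forall x y, U x -> U y -> E r x y -> l x = l y) /\
  (forall x y, U x -> U y -> l x = l y -> E M x y).

Definition coverable (T : Type) (E : R -> T -> T -> Prop) (n : nat)
    (r M : R) (Z : set T) := exists U : nat -> set T,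
  (forall x, Z x -> exists2 j, (j <= n)%N & U j x) /\
  (forall j, components_le E r M (U j)).

Definition coarse_dim_le (T : Type) (E : R -> T -> T -> Prop) (n : nat) :=
  forall r, 0 <= r -> exists M, coverable E n r M setT.

Section OneSpace.
Variables (T : Type) (E : R -> T -> T -> Prop).
Implicit Types (U : set T) (r M : R).

(** The set-valued label of [x] consists of the points of [U] sharing an [L]-label with [x].
    Reflexivity at scale [r] makes [L]-labels unique on [U]. *)
Lemma components_leI (L : Type) (P : T -> L -> Prop) r M U :
    (forall x, U x -> exists a, P x a) ->
    (forall x y a b, U x -> U y -> P x a -> P y b -> E r x y -> a = b) ->
    (forall x y a, U x -> U y -> P x a -> P y a -> E M x y) ->
    (forall x, U x -> E r x x) ->
  components_le E r M U.
Proof.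
move=> Pex Pr PM Erefl.
exists (fun x => [set y | U y /\ exists2 a, P x a & P y a]); split.
  move=> x y Ux Uy xy; have [a Pa] := Pex x Ux; have [b Pb] := Pex y Uy.
  have ab : a = b by exact: Pr Pa Pb xy.
  subst b; apply/seteqP; split => z /= [Uz [c Pc Pz]]; split => //.
    by exists a => //; rewrite (Pr _ _ _ _ Ux Ux Pa Pc (Erefl _ Ux)).
  by exists a => //; rewrite (Pr _ _ _ _ Uy Uy Pb Pc (Erefl _ Uy)).
move=> x y Ux Uy lxy; have [a Pa] := Pex y Uy.
have : [set z | U z /\ exists2 a, P y a & P z a] y by split=> //; exists a.
by rewrite -lxy => -[_ [b Pxb Pyb]]; exact: PM Pxb Pyb.
Qed.

Hypothesis E_ok : scale_rel E.

Lemma components_leW r M M' U U' : M <= M' -> U' `<=` U ->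
  components_le E r M U -> components_le E r M' U'.
Proof.
move=> MM' sU [l [lr lM]]; exists l; split=> x y /sU Ux /sU Uy.
  exact: lr.
by move=> lxy; apply: scale_mono MM' _; [|exact: lM].
Qed.

Lemma components_le0 r M : components_le E r M set0.
Proof. by exists (fun=> set0); split. Qed.

(* A visit to [A] is followed, along an r-chain in [A `|` B], by another one
   within distance [D + 2 * r], so that [A] absorbs the components of [B] that
   it touches. *)
Lemma components_leU r D s M A B : 0 <= r -> 0 <= D -> 0 <= M ->
    r + D + r <= s ->
    components_le E s M A -> components_le E r D B ->
  components_le E r (M + 2 * (D + r)) (A `|` B).
Proof.
move=> r0 D0 M0 hs [a [aS aM]] [b [bR bD]].
(* [p] is a point of [A] equal to [x] or within [r] of the [b]-class of [x]. All such [p] lie within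
   [r + D + r] of each other, hence share their [a]-label. *)
pose near x p := A p /\
  (x = p \/ B x /\ exists q, [/\ B q, b q = b x & E r p q]).
have nearE x p : near x p -> E (D + r) x p.
  case=> Ap [->|[Bx [q [Bq bq pq]]]]; first by apply: scale_refl => //; lra.
  by apply: (scale_trans E_ok) (scale_sym E_ok pq); exact: bD.
have near_uniq x p p' : near x p -> near x p' -> a p = a p'.
  move=> nxp nxp'; have [Ap hp] := nxp; have [Ap' hp'] := nxp'; apply: aS => //.
  case: hp => [xp|[Bx [q [Bq bq pq]]]].
    rewrite -xp; apply: (scale_mono E_ok) (nearE _ _ nxp'); lra.
  case: hp' => [xp'|[_ [q' [Bq' bq' pq']]]].
    rewrite -xp'; apply/(scale_sym E_ok).
    by apply: (scale_mono E_ok) (nearE _ _ nxp); lra.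
  apply: (scale_mono E_ok hs).
  apply: (scale_trans E_ok) (scale_sym E_ok pq').
  by apply: (scale_trans E_ok pq); apply: bD; rewrite // bq.
have near_step x y p : near x p -> B y -> E r x y -> near y p.
  move=> [Ap [->|[Bx [q [Bq bq pq]]]]] By xy; split=> //; right; split=> //.
    by exists y.
  by exists q; split=> //; rewrite bq; exact: bR.
(* Points that [A] absorbs take the label of [A]; the others, all in [B], keep their own. *)
pose P x (c : set T + set T) := match c with
  | inl c => exists2 p, near x p & a p = c
  | inr c => (forall p, ~ near x p) /\ b x = c end.
have nearA x : A x -> near x x by split=> //; left.
apply: (@components_leI _ P).
- move=> x _; have [[p xp]|nx] := pselect (exists p, near x p).
    by exists (inl (a p)); exists p.
  by exists (inr (b x)); split=> // p xp; apply: nx; exists p.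
- have mixed x y p : (A `|` B) y -> near x p -> (forall q, ~ near y q) ->
      E r x y -> False.
    move=> [/nearA yy _ /(_ _ yy) //|By] xp ny xy.
    exact: (ny p (near_step _ _ _ xp By xy)).
  move=> x y [c|c] [c'|c'] Ux Uy /=.
  + move=> [p xp <-] [q yq <-] xy; congr inl.
    have [By|nBy] := pselect (B y).
      exact: (near_uniq y) (near_step _ _ _ xp By xy) yq.
    have [Bx|nBx] := pselect (B x).
      apply: (near_uniq x) xp (near_step _ _ _ yq Bx _).
      exact: (scale_sym E_ok).
    case: xp yq => Ap [xp|[//]] [Aq [yq|[//]]].
    apply: aS => //; rewrite -xp -yq; apply: (scale_mono E_ok) xy; lra.
  + by move=> [p xp _] [ny _] xy; case: (mixed x y p).
  + by move=> [nx _] [q yq _] /(scale_sym E_ok) yx; case: (mixed y x q).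
  + move=> [nx <-] [ny <-] xy; congr inr; apply: bR => //.
      by case: Ux => // /nearA /nx.
    by case: Uy => // /nearA /ny.
- move=> x y [c|c] Ux Uy /=.
    move=> [p xp <-] [q yq apq].
    apply: (@scale_mono _ _ E_ok ((D + r) + M + (D + r))); first by lra.
    apply: (scale_trans E_ok) (scale_sym E_ok (nearE _ _ yq)).
    apply: (scale_trans E_ok (nearE _ _ xp)).
    by apply: aM; [case: xp|case: yq|].
  move=> [nx <-] [ny bxy]; apply: (@scale_mono _ _ E_ok D); first by lra.
  apply: bD => //; first by case: Ux => // /nearA /nx.
  by case: Uy => // /nearA /ny.
- by move=> x _; exact: scale_refl.
Qed.

(** No r-step leads from one piece to another, so the pair of a piece and a label inside it is a
    label on [W]. *)
Lemma components_le_pieces (K : Type) (P : T -> K -> Prop) r M W : 0 <= r ->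
    (forall x, W x -> exists a, P x a) ->
    (forall x y a b, W x -> W y -> P x a -> P y b -> E r x y -> a = b) ->
    (forall a, components_le E r M (W `&` [set x | P x a])) ->
  components_le E r M W.
Proof.
move=> r0 Pex Pr /choice[l lP].
apply: (@components_leI _ (fun x (c : K * set T) => P x c.1 /\ l c.1 x = c.2)).
- by move=> x /Pex[a Pa]; exists (a, l a x).
- move=> x y [a c] [b e] Wx Wy /= [Pa <-] [Pb <-] xy.
  have ab := Pr _ _ _ _ Wx Wy Pa Pb xy; subst b.
  by have [lr _] := lP a; rewrite (lr x y).
- move=> x y [a c] Wx Wy /= [Px <-] [Py lxy].
  by have [_ lM] := lP a; exact: lM.
- by move=> x _; exact: scale_refl.
Qed.

End OneSpace.

(** * A Hurewicz theorem *)

Section Hurewicz.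
Variables (X Y : Type) (EX : R -> X -> X -> Prop) (EY : R -> Y -> Y -> Prop).
Hypotheses (EX_ok : scale_rel EX) (EY_ok : scale_rel EY).
Variables (f : X -> Y) (m : nat).

Definition fibres_coarse_dim_le := forall s S, 0 <= s ->
  exists M, forall C : set Y,
  (forall y y', C y -> C y' -> EY S y y') -> coverable EX m s M (f @^-1` C).

Hypothesis fibres_dim : fibres_coarse_dim_le.
Variables (r rho : R).
Hypotheses (r_ge0 : 0 <= r) (rho_ge0 : 0 <= rho).
Hypothesis f_bornologous : forall x x', EX r x x' -> EY rho (f x) (f x').

(** The classes of [l] are S-bounded, so a single [M] serves the preimages of all of them. *)
Lemma coverable_fibres s S (U : set Y) (l : Y -> set Y) : 0 <= s ->
    (forall y y', U y -> U y' -> l y = l y' -> EY S y y') ->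
  exists M (A : set Y -> nat -> set X), [/\ 0 <= M,
    forall x, U (f x) -> exists2 j, (j <= m)%N & A (l (f x)) j x &
    forall a j, components_le EX s M (A a j)].
Proof.
move=> s0 lS; have [M' hM] := fibres_dim S s0.
have /choice[A hA] a : exists A : nat -> set X,
    (forall x, U (f x) /\ l (f x) = a -> exists2 j, (j <= m)%N & A j x) /\
    (forall j, components_le EX s M' (A j)).
  apply: (hM [set y | U y /\ l y = a]).
  by move=> y y' [Uy <-] [Uy' ly']; exact: lS.
exists (Num.max M' 0), A; split.
- by rewrite le_max lexx orbT.
- by move=> x Ux; have [hA1 _] := hA (l (f x)); exact: hA1.
- move=> a j; have [_ /(_ j)] := hA a; apply: components_leW => //.
  by rewrite le_max lexx.
Qed.

(* [U] is coloured by a covering of the fibres at a scale exceeding the bound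
   [D] of the given colouring [V]. Colour [c <= m] uses [V c] only near [U],
   where its pieces cannot connect distinct components of [U], and is empty at
   distances between [c * rho] and [c.+1 * rho] from [U]; beyond that gap it is
   reused for [V c.+1]. The part of [V 0] far from [U] gets the new colour. *)
Lemma coverable_step S (U : set Y) (K : nat) D (Z : set X) :
    (m <= K)%N -> components_le EY (m.*2.+1%:R * rho) S U ->
    coverable EX K r D Z ->
  exists M, coverable EX K.+1 r M (Z `|` f @^-1` U).
Proof.
move=> mK [l [lr lS]] [V [VZ Vb]].
pose D' := Num.max D 0.
have D'0 : 0 <= D' by rewrite le_max lexx orbT.
have {}Vb c : components_le EX r D' (V c).
  by apply: components_leW (Vb c) => //; rewrite le_max lexx.
have rDr0 : 0 <= r + D' + r by rewrite !addr_ge0.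
(* At scale [r + D' + r] the colours of a fibre can absorb the D'-bounded pieces of [V]. *)
have [M [A [M0 Acov Ab]]] := coverable_fibres rDr0 lS.
pose near (c : nat) y u := U u /\ EY (c%:R * rho) y u.
have crho0 c : 0 <= c%:R * rho by rewrite mulr_ge0.
pose W c : set X := if (c <= m)%N then
    [set x | [\/ U (f x) /\ A (l (f x)) c x,
                 V c x /\ exists u, near c (f x) u
               | [/\ (c < m)%N, V c.+1 x & ~ exists u, near c.+1 (f x) u]]]
  else if c == K.+1 then [set x | V 0%N x /\ ~ exists u, near 0%N (f x) u]
  else V c.
have nearU c y : U y -> exists u, near c y u.
  by move=> Uy; exists y; split=> //; exact: scale_refl.
exists (M + 2 * (D' + r)), W; split.
  move=> x [|Ux]; last first.
    by have [j jm Aj] := Acov x Ux; exists j; [lia|rewrite /W jm; apply: Or31].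
  move=> /VZ[c cK Vc].
  have [nc|fc] := pselect (exists u, near c (f x) u).
    exists c; first by lia.
    rewrite /W; case: ifPn => cm; first exact: Or32.
    by rewrite ifF //; apply/eqP; lia.
  case: c cK Vc fc => [|c] cK Vc fc.
    by exists K.+1 => //; rewrite /W ifF ?eqxx //; lia.
  have [cm|cm] := leqP c.+1 m.
    by exists c; [lia|rewrite /W ifT; [exact: Or33|lia]].
  exists c.+1; first by lia.
  by rewrite /W ifF ?ifF//; [apply/eqP; lia|lia].
have leM : D' <= M + 2 * (D' + r) by move: M0 D'0 r_ge0; move: (D') => d; lra.
move=> c; rewrite /W; case: ifPn => cm; last first.
  case: ifP => _; last exact: (components_leW EX_ok leM _ (Vb c)).
  by apply: (components_leW EX_ok leM _ (Vb 0%N)) => x [].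
have crhoS : c.+1%:R * rho = c%:R * rho + rho by rewrite -natr1 mulrDl mul1r.
(* Two points within [c * rho] of [U] and one r-step apart have their nearby points of [U] within
   [(2 * c + 1) * rho]; [c <= m] accounts for the scale in the hypothesis on [U]. *)
have cleR : c%:R * rho + (rho + c%:R * rho) <= m.*2.+1%:R * rho.
  have -> : c%:R * rho + (rho + c%:R * rho) = c.*2.+1%:R * rho.
    by rewrite -natr1 -addnn natrD; ring.
  by rewrite ler_wpM2r // ler_nat; lia.
pose P x (a : option (set Y)) := match a with
  | Some a => exists u, near c (f x) u /\ l u = a
  | None => ~ exists u, near c (f x) u end.
have nearS x y u : near c (f x) u -> EX r x y -> near c.+1 (f y) u.
  move=> [Uu xu] /f_bornologous xy; split=> //.
  by rewrite crhoS addrC; exact: (scale_trans EY_ok (scale_sym EY_ok xy)).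
have near_eq x y u v : near c (f x) u -> near c (f y) v -> EX r x y ->
    l u = l v.
  move=> [Uu xu] [Uv yv] /f_bornologous xy; apply: lr => //.
  apply: (scale_mono EY_ok cleR).
  apply: (scale_trans EY_ok (scale_sym EY_ok xu)).
  exact: (scale_trans EY_ok xy).
apply: (@components_le_pieces _ _ EX_ok _ P) => //.
- move=> x _; have [[u xu]|nx] := pselect (exists u, near c (f x) u).
    by exists (Some (l u)), u.
  by exists None.
(* Colour [c] far from [U] comes only from [V c.+1] beyond [c.+1 * rho], and an r-step adds at most
   [rho], so it cannot cross the gap. *)
- have mixed x y u : near c (f x) u -> EX r x y -> 
      [\/ U (f y) /\ A (l (f y)) c y,
          V c y /\ exists u, near c (f y) u
        | [/\ (c < m)%N, V c.+1 y & ~ exists u, near c.+1 (f y) u]] ->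
      ~ (exists u, near c (f y) u) -> False.
    move=> xu xy [[/(nearU c) //]|[_ //]|[_ _ []]].
    by exists u; exact: nearS xu xy.
  move=> x y [a|] [b|] Wx Wy //=.
  + move=> [u [xu <-]] [v [yv <-]] xy; congr Some; exact: near_eq xu yv xy.
  + by move=> [u [xu _]] ny xy; case: (mixed x y u).
  + by move=> nx [u [yu _]] /(scale_sym EX_ok) yx; case: (mixed y x u).
case=> [a|].
  have := components_leU EX_ok r_ge0 D'0 M0 (lexx _) (Ab a c) (Vb c).
  apply: components_leW => // x [[[Ux Ax]|[Vx _]|[_ _ fx]] [u [xu ua]]].
  - left; rewrite -ua (_ : l u = l (f x)) //; apply: lr => //.
      by case: xu.
    case: xu => _ /(scale_sym EY_ok); apply: (scale_mono EY_ok).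
    by apply: le_trans cleR; rewrite lerDl addr_ge0.
  - by right.
  - case: fx; exists u; have [Uu yu] := xu; split=> //.
    by apply: (scale_mono EY_ok) yu; rewrite crhoS lerDl.
apply: components_leW (Vb c.+1) => // x [[[/(nearU c)//]|[_ //]|[]//]].
Qed.

Lemma coverable_hurewicz n S : coverable EY n (m.*2.+1%:R * rho) S setT ->
  exists M, coverable EX (m + n) r M setT.
Proof.
move=> [U [Ucov Ub]].
have ind j : exists M, coverable EX (m + j) r M
    [set x | exists2 i, (i <= j)%N & U i (f x)].
  elim: j => [|j [M IH]]; last first.
    have := coverable_step (leq_addr j m) (Ub j.+1) IH => -[M' [W [Wcov Wb]]].
    exists M', W; rewrite addnS; split=> // x [i ij Ui]; apply: Wcov.
    move: ij Ui; rewrite leq_eqVlt => /orP[/eqP-> |ij] Ui; first by right.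
    by left; exists i.
  (* Preimages of distinct classes of [U 0] are not joined by r-steps, so their colourings combine
     with [m + 1] colours. *)
  have [l [lr lS]] := Ub 0%N.
  have [M [A [M0 Acov Ab]]] := coverable_fibres r_ge0 lS.
  exists M, (fun j => [set x | U 0%N (f x) /\ A (l (f x)) j x]); split.
    move=> x [i]; rewrite leqn0 => /eqP -> Ux; have [j jm Aj] := Acov x Ux.
    by exists j => //; rewrite addn0.
  move=> j; apply: (@components_le_pieces _ _ EX_ok _ (fun x a => l (f x) = a)).
  - by [].
  - by move=> x _; exists (l (f x)).
  - move=> x y a b [Ux _] [Uy _] <- <- /f_bornologous xy; apply: lr => //.
    apply: scale_mono xy => //.
    by rewrite -[leLHS]mul1r ler_wpM2r // ler1n.
  - by move=> a; apply: components_leW (Ab a j) => // x [[_ +] <-].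
have [M [W [Wcov Wb]]] := ind n; exists M, W; split=> // x _; apply: Wcov.
exact: Ucov.
Qed.

End Hurewicz.
End ScaleRelations.
(** * Asymptotic dimension of box spaces on the group level *)

Section RComponents.
Variables (R : realType) (T : choiceType) (d : T -> T -> R).
Implicit Types (U : set T) (x y : T).

Lemma r_component_refl r U x : U x -> r_component d r U x x.
Proof. by move=> Ux; exists [::]; split=> // z; rewrite inE => /eqP->. Qed.

Lemma r_component_step r U x y : (forall x y, d x y = d y x) ->
  U x -> U y -> d x y <= r -> r_component d r U x = r_component d r U y.
Proof.
move=> dC Ux Uy xy.
have step u v : U u -> d u v <= r ->
    r_component d r U v `<=` r_component d r U u.
  move=> Uu uv z [s [vs vz Us]]; exists (v :: s); split=> //=.
    by rewrite uv.
  by move=> w; rewrite inE => /orP[/eqP->//|/Us].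
by apply/seteqP; split; apply: step => //; rewrite dC.
Qed.

Lemma r_component_diam r M U x y : (diam d (r_component d r U x) <= M%:E)%E ->
  U x -> U y -> r_component d r U x = r_component d r U y -> d x y <= M.
Proof.
move=> diamM Ux Uy xy; rewrite -lee_fin; apply: le_trans diamM.
apply: ereal_sup_ubound; exists x; first exact: r_component_refl.
by exists y => //; rewrite xy; exact: r_component_refl.
Qed.

(** [l] is constant along r-chains in [U], hence on each r-component. *)
Lemma diam_r_component_le (L : Type) (l : T -> L) r M U x :
    (forall x y, U x -> U y -> d x y <= r -> l x = l y) ->
    (forall x y, U x -> U y -> l x = l y -> d x y <= M) ->
  (diam d (r_component d r U x) <= M%:E)%E.
Proof.
move=> lr lM.
have lcomp z : r_component d r U x z -> U z /\ l x = l z.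
  move=> [s]; elim: s x => [|y s IH] u /= [].
    by move=> _ <- Us; split=> //; apply: Us; exact: mem_head.
  move=> /andP[uy ys] yz Us.
  have [|Uz <-] := IH y.
    by split=> // w ws; apply: Us; rewrite inE ws orbT.
  split=> //; apply: lr uy; first exact: Us (mem_head _ _).
  by apply: Us; rewrite !inE eqxx orbT.
apply: ge_ereal_sup => _ [y /lcomp[Uy xy] [z /lcomp[Uz xz] <-]].
by rewrite lee_fin; apply: lM; rewrite // -xy.
Qed.

End RComponents.

(** * Proper right-invariant metrics and distances modulo subgroups *)

Section ProperMetrics.
Variable R : realType.

Lemma finite_uniform_bound (T : eqType) (S : set T) (P : T -> R -> Prop) :
    finite_set S -> (forall x s t, s <= t -> P x s -> P x t) ->
    (forall x, S x -> exists t, P x t) ->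
  exists t, forall x, S x -> P x t.
Proof.
move=> /finite_seqP[s ->] Pmono; elim: s => [|a s IH] Pex; first by exists 0.
have [|t ht] := IH; first by move=> x xs; apply: Pex; rewrite /= inE xs orbT.
have [u Pu] := Pex a (mem_head _ _).
exists (Num.max t u) => x /=; rewrite inE => /orP[/eqP->|xs].
  by apply: Pmono Pu; rewrite le_max lexx orbT.
by apply: Pmono (ht x xs); rewrite le_max lexx.
Qed.

Section OneGroup.
Variables (G : groupType) (d : G -> G -> R).
Hypothesis d_ok : proper_right_invariant_metric d.

Let dxx x : d x x = 0. Proof. by have [[/(_ x x)[_ ->]]] := d_ok. Qed.
Let dC x y : d x y = d y x. Proof. by have [[]] := d_ok. Qed.
Let dD x y z : d x z <= d x y + d y z. Proof. by have [[]] := d_ok. Qed.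
Let dM x y g : d (x * g)%g (y * g)%g = d x y.
Proof. by have [_ ->] := d_ok. Qed.

Lemma metric_ge0 x y : 0 <= d x y.
Proof. by have := dD x y x; rewrite dxx (dC y x); lra. Qed.

Lemma dist_mulVr x y : d 1%g (y * x^-1)%g = d x y.
Proof. by rewrite -(dM _ _ x) mulgVK mul1g. Qed.

(** Properness enters here: over a finite ball, pointwise bounds have a maximum. *)
Lemma ball_uniform_bound (P : G -> R -> Prop) r :
    (forall x s t, s <= t -> P x s -> P x t) ->
    (forall x, d 1%g x <= r -> exists t, P x t) ->
  exists t, forall x, d 1%g x <= r -> P x t.
Proof.
by have [_ _ dfin] := d_ok; exact: finite_uniform_bound (dfin 1%g r).
Qed.

(** By right invariance, one of two representatives realising a distance between left cosets can be
    prescribed, so a single factor [k] suffices. *)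
Definition coset_scale (H : nat -> set G) (r : R) (x y : nat * G) :=
  x.1 = y.1 /\ exists2 k, H x.1 k & d x.2 (y.2 * k)%g <= r.

Definition is_subgroup (H : set G) := [/\ H 1%g,
  forall g h, H g -> H h -> H (g * h)%g & forall g, H g -> H g^-1%g].

Variable H : nat -> set G.
Hypothesis H_subgroup : forall i, is_subgroup (H i).

Lemma coset_scale_rel : scale_rel (coset_scale H).
Proof.
split.
- move=> r x r0; split=> //; have [H1 _ _] := H_subgroup x.1.
  by exists 1%g; rewrite // mulg1 dxx.
- move=> r [i x] [j y] [/= <- [k Hk xy]]; split=> //=.
  have [_ _ HV] := H_subgroup i; exists k^-1%g; first exact: HV.
  by rewrite dC -(dM _ _ k) mulgVK.
- move=> r s [i x] [j y] [h z] [/= <- [k Hk xy]] [/= <- [l Hl yz]]; split=> //=.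
  have [_ HM _] := H_subgroup i; exists (l * k)%g; first exact: HM.
  apply: le_trans (dD _ (y * k)%g _) _; apply: lerD => //.
  by rewrite mulgA dM.
- move=> r s x y rs [xy1 [k Hk xy]]; split=> //; exists k => //.
  exact: (le_trans xy rs).
Qed.

Lemma set_dist_left_coset_le K g h k : K 1%g -> K k ->
  set_dist d (left_coset g K) (left_coset h K) <= d g (h * k)%g.
Proof.
move=> K1 Kk; apply: ge_inf.
  by exists 0 => _ [x _ [y _ <-]]; exact: metric_ge0.
exists g; first by exists 1%g; rewrite ?mulg1.
by exists (h * k)%g => //; exists k.
Qed.

(** The infimum is approached within 1, and right translation moves the first representative to
    [g]. *)
Lemma set_dist_left_coset_adherent K g h r : is_subgroup K ->
    set_dist d (left_coset g K) (left_coset h K) <= r ->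
  exists2 k, K k & d g (h * k)%g <= r + 1.
Proof.
move=> [K1 KM KV] ghr.
have [||_ [_ [k Kk <-] [_ [l Kl <-] <-]] kl] :=
    @inf_adherent R [set d x y | x in left_coset g K & y in left_coset h K] 1.
- by [].
- split; last by exists 0 => _ [x _ [y _ <-]]; exact: metric_ge0.
  exists (d (g * 1)%g (h * 1)%g), (g * 1)%g; first by exists 1%g.
  by exists (h * 1)%g => //; exists 1%g.
exists (l * k^-1)%g; first by apply: KM => //; exact: KV.
rewrite -(dM _ _ k) !mulgA mulgVK; move: kl; rewrite -/(set_dist _ _ _); lra.
Qed.

Lemma set_distC A B : set_dist d A B = set_dist d B A.
Proof.
congr inf; apply/seteqP; split => _ [x Ax [y By <-]];
  by exists y => //; exists x => //; rewrite dC.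
Qed.

Lemma set_dist_ge0 A B : A !=set0 -> B !=set0 -> 0 <= set_dist d A B.
Proof.
move=> [x Ax] [y By]; apply: lb_le_inf.
  by exists (d x y), x => //; exists y.
by move=> _ [u _ [v _ <-]]; exact: metric_ge0.
Qed.

Lemma box_distC x y : box_dist d (H := H) x y = box_dist d (H := H) y x.
Proof.
by rewrite /box_dist eq_sym; case: ifP => _; [exact: set_distC|exact: addrC].
Qed.

Let diam_coset i := diam (@coset_dist R G d (H i)) setT.

(** Finite index makes the diameter finite, so that [fine] returns it and not the default 0. *)
Lemma coset_dist_le_diam i (A B : coset_space (H i)) : finite_index (H i) ->
  coset_dist d A B <= fine (diam_coset i).
Proof.
move=> fin_i.
have [t ht] : exists t, forall A, left_cosets (H i) A ->
    forall B, left_cosets (H i) B -> set_dist d A B <= t.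
  apply: (finite_uniform_bound fin_i) => [C s t st Cs D HD|C HC].
    exact: le_trans (Cs D HD) st.
  apply: (finite_uniform_bound (P := fun D t => set_dist d C D <= t) fin_i).
    by move=> D s t st /= Ds; exact: (le_trans Ds st).
  by move=> D HD; exists (set_dist d C D).
have AB_diam : ((coset_dist d A B)%:E <= diam_coset i)%E.
  by apply: ereal_sup_ubound; exists A => //; exists B.
have diam_t : (diam_coset i <= t%:E)%E.
  apply: ge_ereal_sup => _ [C _ [D _ <-]]; rewrite lee_fin.
  by apply: ht; [exact: set_mem (valP C)|exact: set_mem (valP D)].
rewrite -lee_fin fineK // fin_numElt.
by rewrite (lt_le_trans (ltNyr _) AB_diam) (le_lt_trans diam_t (ltry _)).
Qed.

Lemma fine_diam_ge0 i : finite_index (H i) -> 0 <= fine (diam_coset i).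
Proof.
move=> fin_i; pose A := coset_map (H i) 1%g.
apply: le_trans (coset_dist_le_diam A A fin_i).
have A1 : val A !=set0.
  by have [H1 _ _] := H_subgroup i; exists (1 * 1)%g, 1%g.
exact: set_dist_ge0.
Qed.

Let coset_point (x : nat * G) : box_space H :=
  existT (fun i => coset_space (H i)) x.1 (coset_map (H x.1) x.2).

Lemma box_dist_coset_point r x y : coset_scale H r x y ->
  box_dist d (coset_point x) (coset_point y) <= r.
Proof.
case: x y => [i g] [j h] [/= <- [k Hk ghk]].
rewrite /box_dist /= eqxx; apply: le_trans ghk.
by apply: set_dist_left_coset_le => //; have [] := H_subgroup i.
Qed.

Lemma coset_scale_box_dist r x y : x.1 = y.1 ->
    box_dist d (coset_point x) (coset_point y) <= r ->
  coset_scale H (r + 1) x y.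
Proof.
case: x y => [i g] [j h] /= <-; rewrite /box_dist /= eqxx => ghr.
by split=> //; exact: set_dist_left_coset_adherent ghr.
Qed.

Lemma coset_pointP (x : box_space H) : exists y, coset_point y = x.
Proof.
case: x => i [A HA]; have [g _ gA] := set_mem HA.
exists (i, g); congr existT; exact: val_inj.
Qed.

Lemma coarse_dim_le_box n :
  asdim_le (box_dist d (H := H)) n -> coarse_dim_le (coset_scale H) n.
Proof.
move=> dim_n r r0; pose r' := Num.max r 1.
have [|M [_ [U [Ucov UM]]]] := dim_n r'; first by rewrite lt_max ltr01 orbT.
exists (M + 1).
(* Colours beyond [n], where [inord] would return a default, are empty. *)
exists (fun j => if (j <= n)%N then coset_point @^-1` U (inord j) else set0).
split.
  move=> x _; have : [set: box_space H] (coset_point x) by [].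
  rewrite -Ucov => -[j _ Uj]; exists j; first by rewrite -ltnS.
  by rewrite -ltnS ltn_ord /= inord_val.
move=> j; case: ifP => _; last exact: components_le0.
(* An r'-component of the box space may meet several quotients; the index in the label splits it. *)
apply: (@components_leI _ _ _ _
  (fun x a => a = (x.1,
    r_component (box_dist d (H := H)) r' (U (inord j)) (coset_point x)))).
- by move=> x _; eexists.
- move=> x y _ _ Ux Uy -> -> xy; congr pair; first by case: xy.
  apply: r_component_step => //; first exact: box_distC.
  apply: le_trans (box_dist_coset_point xy) _.
  by rewrite le_max lexx.
- move=> x y _ Ux Uy -> [xy /(r_component_diam (UM _ _ Ux) Ux Uy)].
  exact: coset_scale_box_dist.
- by move=> x _; apply: scale_refl => //; exact: coset_scale_rel.
Qed.

Lemma box_coarse_dim_le n : (forall i, finite_index (H i)) ->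
  coarse_dim_le (coset_scale H) n -> asdim_le (box_dist d (H := H)) n.
Proof.
move=> fin dim_n r r0; have [|M [U [Ucov Ub]]] := dim_n (r + 1); first by lra.
have /choice[lift liftK] := coset_pointP.
have tag_lift x : (lift x).1 = tag x by rewrite -[in RHS](liftK x).
pose D x := fine (diam_coset (@tag nat (fun i => coset_space (H i)) x)).
have D0 x : 0 <= D x by exact: fine_diam_ge0.
have M0 : 0 < Num.max M (2 * r) by rewrite lt_max; apply/orP; right; lra.
exists (Num.max M (2 * r)); split=> //.
exists (fun j => lift @^-1` U j); split.
  apply/seteqP; split=> // x _; have [//|j jn Uj] := Ucov (lift x).
  by exists (inord j) => //=; rewrite inordK.
move=> j x _; have [l [lr lM]] := Ub j.
(* All quotients of diameter at most [r] share the label [None]: their points are within [2 * r] of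
   each other, and only they have points within [r] of another quotient. *)
apply: (diam_r_component_le
  (l := fun x => if D x <= r then None else Some (l (lift x)))) => {}x y Ux Uy.
  move=> xy; have [xy_tag|xy_tag] := eqVneq (tag x) (tag y).
    rewrite /D xy_tag; case: ifP => // _; congr Some; apply: lr => //.
    by apply: coset_scale_box_dist; rewrite ?tag_lift // !liftK.
  have : D x + D y <= r by move: xy; rewrite /box_dist (negPf xy_tag).
  by have := D0 x; have := D0 y => ? ? ?; rewrite !ifT //; lra.
case: ifP => Dx; case: ifP => // Dy.
  move=> _; rewrite le_max; apply/orP; right.
  rewrite /box_dist; case: ifP => [/eqP xy_tag|_]; last first.
    by rewrite mulr_natl mulr2n lerD.
  clear Ux Uy; case: x y Dx Dy xy_tag => i A [k B] /= Dx Dy ik; subst k.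
  apply: le_trans (coset_dist_le_diam A B (fin i)) _.
  by rewrite /D /= in Dx; lra.
move=> [] /lM xy; rewrite -[x]liftK -[y]liftK le_max; apply/orP; left.
by apply: box_dist_coset_point; exact: xy.
Qed.

End OneGroup.
(** * Group extensions *)

Section GroupHom.
Variables (G G' : groupType) (phi : {multiplicative G -> G'}).

Lemma hom1 : phi 1%g = 1%g.
Proof. by apply: (@mulgI _ (phi 1%g)); rewrite -gmulfM !mulg1. Qed.

Lemma homV x : phi x^-1%g = (phi x)^-1%g.
Proof. by apply: (@mulgI _ (phi x)); rewrite -gmulfM !mulgV hom1. Qed.

End GroupHom.

(** Right invariance reduces the claim to the finite ball around 1. *)
Lemma hom_bornologous (G G' : groupType) (d : G -> G -> R) (d' : G' -> G' -> R)
    (phi : {multiplicative G -> G'}) r :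
    proper_right_invariant_metric d -> proper_right_invariant_metric d' ->
  exists t, forall g h, d g h <= r -> d' (phi g) (phi h) <= t.
Proof.
move=> d_ok d'_ok.
have [t ht] : exists t, forall x, d 1%g x <= r -> d' 1%g (phi x) <= t.
  apply: (ball_uniform_bound d_ok) => [x s t st xs|x _].
    exact: le_trans xs st.
  by exists (d' 1%g (phi x)).
exists t => g h; rewrite -(dist_mulVr d_ok) => /ht.
by rewrite gmulfM homV (dist_mulVr d'_ok).
Qed.

Section Extension.
Variables (Delta Gamma Lambda : groupType).
Variables (iota : {multiplicative Delta -> Gamma}).
Variables (pi : {multiplicative Gamma -> Lambda}).
Hypothesis exact_Gamma : range iota = [set g | pi g = 1%g].
Hypothesis pi_surj : range pi = [set: Lambda].
Variable N : nat -> normal_subgroup Gamma.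
Hypothesis N_decr : forall i, N i.+1 `<=` N i.
Hypothesis N_separates : let q := quotient_map (bigcap_normal N) in
  separates (fun i => q @` N i) (q @` range iota).
Variables (dDelta : Delta -> Delta -> R) (dGamma : Gamma -> Gamma -> R).
Variable dLambda : Lambda -> Lambda -> R.
Hypothesis dDelta_ok : proper_right_invariant_metric dDelta.
Hypothesis dGamma_ok : proper_right_invariant_metric dGamma.
Hypothesis dLambda_ok : proper_right_invariant_metric dLambda.

Let EDelta := coset_scale dDelta (fun i => iota @^-1` N i).
Let EGamma := coset_scale dGamma (fun i => N i).
Let ELambda := coset_scale dLambda (fun i => pi @` N i).

Lemma normal_is_subgroup i : is_subgroup (N i).
Proof. by split; [exact: nsubg1|exact: nsubgM|exact: nsubgV]. Qed.

Lemma preimage_is_subgroup i : is_subgroup (iota @^-1` N i).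
Proof.
split=> [|g h|g] /=; rewrite ?hom1 ?gmulfM ?homV; first exact: nsubg1.
  exact: nsubgM.
exact: nsubgV.
Qed.

Lemma image_is_subgroup i : is_subgroup (pi @` N i).
Proof.
split=> [|_ _ [g Ng <-] [h Nh <-]|_ [g Ng <-]].
- by exists 1%g; [exact: nsubg1|rewrite hom1].
- by exists (g * h)%g; [exact: nsubgM|rewrite gmulfM].
- by exists g^-1%g; [exact: nsubgV|rewrite homV].
Qed.

Lemma normal_decr i j : (i <= j)%N -> N j `<=` N i.
Proof.
move=> /subnK <-; elim: (j - i)%N => // n IH.
by rewrite addSn; apply: subset_trans IH.
Qed.

(** By normality, right translation by [g] replaces the factor [k] by its conjugate [k ^ g]. *)
Lemma coset_scale_mulr r i a b g :
  EGamma r (i, a) (i, b) -> EGamma r (i, a * g)%g (i, b * g)%g.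
Proof.
move=> [_ [k Nk abk]]; split=> //=; exists (k ^ g)%g; first exact: nsubgJ.
have [_ dM _] := dGamma_ok.
by rewrite /conjg !mulgA mulgK dM.
Qed.

Lemma ball_lift S : exists T, forall b, dLambda 1%g b <= S ->
  exists2 g, pi g = b & dGamma 1%g g <= T.
Proof.
apply: (ball_uniform_bound dLambda_ok) => [b s t st [g gb gs]|b _].
  by exists g => //; exact: le_trans gs st.
have : range pi b by rewrite pi_surj.
by move=> [g _ gb]; exists (dGamma 1%g g), g.
Qed.

(* If [b] avoids [Delta] modulo [bigcap_normal N], then some [N i] already
   witnesses it, leaving finitely many stages; otherwise a single representative
   serves them all. *)
Lemma coset_representative_bound s : exists T, forall b, dGamma 1%g b <= s ->
  forall i e, left_coset b (N i) (iota e) ->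
  exists2 e', left_coset b (N i) (iota e') & dDelta 1%g e' <= T.
Proof.
apply: (ball_uniform_bound dGamma_ok (P := fun b T => forall i e,
    left_coset b (N i) (iota e) ->
    exists2 e', left_coset b (N i) (iota e') & dDelta 1%g e' <= T)).
  move=> b t u tu bt i e /bt[e' be' e't].
  by exists e' => //; exact: le_trans e't tu.
move=> b _; pose q := quotient_map (bigcap_normal N).
have qM g h : q (g * h)%g = (q g * q h)%g by exact: gmulfM.
have qV g : q g^-1%g = (q g)^-1%g by exact: homV.
have [[_ [e _ <-] qeb]|/N_separates[i0 ni0]] :=
    pselect ((q @` range iota) (q b)).
  exists (dDelta 1%g e) => i e' _; exists e => //.
  have : left_coset b (bigcap_normal N) (iota e).
    rewrite -[left_coset b _](congr1 val qeb).
    by exists 1%g; [exact: nsubg1|rewrite mulg1].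
  by move=> [k Kk <-]; exists k => //; exact: Kk.
(* For [i >= i0] the factor [k] lies in [N i0], so [q b] and [q (iota e)] would have the same coset
   modulo the image of [N i0]. *)
have stage i e : left_coset b (N i) (iota e) -> (i < i0)%N.
  rewrite ltnNge => -[k Nk be]; apply/negP => i0i; apply: ni0.
  have qNk : (q @` N i0) (q k) by exists k => //; exact: normal_decr Nk.
  exists (q (iota e)); first by exists (iota e) => //; exists e.
  have q_be : q (iota e) = (q b * q k)%g by rewrite -qM be.
  apply/seteqP; split=> _ [_ [l Nl <-] <-]; rewrite ?q_be.
    exists (q (k * l)%g); last by rewrite qM mulgA.
    by exists (k * l)%g => //; apply: nsubgM => //; exact: normal_decr Nk.
  exists (q (k^-1 * l)%g); last by rewrite qM qV !mulgA mulgK.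
  exists (k^-1 * l)%g => //; apply: nsubgM => //; apply: nsubgV.
  exact: normal_decr Nk.
have [T hT] : exists T, forall i, (`I_i0) i -> forall e,
    left_coset b (N i) (iota e) ->
    exists2 e', left_coset b (N i) (iota e') & dDelta 1%g e' <= T.
  apply: finite_uniform_bound; first exact: finite_II.
    move=> i t u tu it e /it[e' be' e't].
    by exists e' => //; exact: le_trans e't tu.
  move=> i _.
  have [[e be]|nbe] := pselect (exists e, left_coset b (N i) (iota e)).
    by exists (dDelta 1%g e) => _ _; exists e.
  by exists 0 => e be; case: nbe; exists e.
by exists T => i e be; apply: (hT i _ e be); exact: stage be.
Qed.

(** [iota b * k * (iota a)^-1] lies in the ball of radius [s], and its coset modulo [N i] contains
    [iota (b * a^-1)]. A bounded [e] with [iota e] in this coset then replaces [b * a^-1]. *)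
Lemma iota_coarse s : exists T, forall i a b,
  EGamma s (i, iota a) (i, iota b) -> EDelta T (i, a) (i, b).
Proof.
have [T hT] := coset_representative_bound s; exists T => i a b [_ [k Nk]].
rewrite -(dist_mulVr dGamma_ok) => /hT /(_ i (b * a^-1)%g)[|/=].
  exists ((k^-1) ^ (iota a)^-1)%g; first exact/nsubgJ/nsubgV.
  by rewrite gmulfM homV /conjg !invgK !mulgA mulgVK mulgK.
move=> e [l Nl le] eT; split=> //; exists (b^-1 * e * a)%g => /=.
  rewrite !gmulfM homV -le !mulgA mulVg mul1g -!mulgA.
  by apply: nsubgM => //; apply: nsubgJ.
rewrite -(dist_mulVr dDelta_ok) !mulgA mulgV mul1g mulgK; exact: eT.
Qed.

Lemma iota_bornologous s : exists T, forall i a b,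
  EDelta s (i, a) (i, b) -> EGamma T (i, iota a) (i, iota b).
Proof.
have [T hT] := hom_bornologous iota s dDelta_ok dGamma_ok.
exists T => i a b [_ [k Nk /hT abk]]; split=> //; exists (iota k) => //.
by rewrite -gmulfM.
Qed.

Let proj (x : nat * Gamma) : nat * Lambda := (x.1, pi x.2).

Lemma proj_bornologous s : exists T, forall x y,
  EGamma s x y -> ELambda T (proj x) (proj y).
Proof.
have [T hT] := hom_bornologous pi s dGamma_ok dLambda_ok.
exists T => x y [xy [k Nk /hT xyk]]; split=> //=.
exists (pi k); first by exists k.
by rewrite -gmulfM.
Qed.

(** The element of [Lambda] between the projections lifts to a bounded [b]; what remains is in the
    kernel of [pi], that is, in the image of [iota]. *)
Lemma fibre_translate S : exists T, forall x y,
  ELambda S (proj x) (proj y) ->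
  x.1 = y.1 /\ exists e, EGamma T x (y.1, iota e * y.2)%g.
Proof.
have [T hT] := ball_lift S; exists T => -[i g] [j h] [/= <- [_ [k Nk <-]]].
rewrite -(dist_mulVr dLambda_ok) => /hT[b pib bT]; split=> //.
have : [set g | pi g = 1%g] (b * g * (h * k)^-1)%g.
  by rewrite /= !gmulfM pib homV gmulfM mulgVK mulgV.
rewrite -exact_Gamma => -[e _ ie]; exists e; split=> //=; exists k => //=.
rewrite ie -(mulgA _ h) mulgVK -(dist_mulVr dGamma_ok) mulgK; exact: bT.
Qed.

(** Once a base point [(i0, g0)] is fixed, each [x] in the fibre is near some [iota (e x) * g0], and
    a covering for [Delta] is pulled back along [e]. *)
Lemma coset_fibres_dim m :
  coarse_dim_le EDelta m -> fibres_coarse_dim_le EGamma ELambda proj m.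
Proof.
move=> dim_m s S s0.
have EG := coset_scale_rel dGamma_ok normal_is_subgroup.
have [T hT] := fibre_translate S.
(* The path goes from [iota (e x) * g0] to [x], then to [y], then to [iota (e y) * g0]. *)
have [rho hrho] := iota_coarse (T + (s + T)).
have [|M0 [V [Vcov Vb]]] := dim_m (Num.max rho 0).
  by rewrite le_max lexx orbT.
have [M1 hM1] := iota_bornologous M0.
exists (T + (M1 + T)) => C CS.
have [[[i0 g0] Cx0]|nC] := pselect (exists x0, C (proj x0)); last first.
  exists (fun=> set0); split; last by move=> j; exact: components_le0.
  by move=> x Cx; case: nC; exists x.
have /choice[e he] x : exists e, C (proj x) ->
    x.1 = i0 /\ EGamma T x (i0, iota e * g0)%g.
  have [Cx|nCx] := pselect (C (proj x)); last by exists 1%g.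
  by have [xi0 [e ex]] := hT _ _ (CS _ _ Cx Cx0); exists e.
exists (fun j => [set x | C (proj x) /\ V j (i0, e x)]); split.
  by move=> x Cx; have [//|j jm Vj] := Vcov (i0, e x); exists j.
move=> j; have [l [lr lM]] := Vb j.
apply: (components_leI (P := fun x a => a = l (i0, e x))).
- by move=> x _; exists (l (i0, e x)).
- move=> x y _ _ [Cx Vx] [Cy Vy] -> -> xy; apply: lr => //.
  have ED := coset_scale_rel dDelta_ok preimage_is_subgroup.
  apply: (@scale_mono _ _ _ ED rho).
    by rewrite le_max lexx.
  apply: hrho; have [_ ex] := he x Cx; have [_ ey] := he y Cy.
  have := scale_trans EG (scale_sym EG ex) (scale_trans EG xy ey).
  by move=> /(coset_scale_mulr g0^-1); rewrite !mulgK.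
- move=> x y _ [Cx Vx] [Cy Vy] ->.
  move=> /(lM _ _ Vx Vy) /hM1 /(coset_scale_mulr g0) xy.
  have [_ ex] := he x Cx; have [_ ey] := he y Cy.
  exact: (scale_trans EG ex (scale_trans EG xy (scale_sym EG ey))).
- by move=> x _; exact: scale_refl.
Qed.

Lemma coset_dim_extension m n : coarse_dim_le EDelta m ->
  coarse_dim_le ELambda n -> coarse_dim_le EGamma (m + n).
Proof.
move=> dim_m dim_n r r0; have [T hT] := proj_bornologous r.
have T0 : 0 <= Num.max T 0 by rewrite le_max lexx orbT.
have EL := coset_scale_rel dLambda_ok image_is_subgroup.
have [|S covS] := dim_n (m.*2.+1%:R * Num.max T 0); first by rewrite mulr_ge0.
have EG := coset_scale_rel dGamma_ok normal_is_subgroup.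
apply: (coverable_hurewicz EG EL (coset_fibres_dim dim_m) r0 T0 _ covS).
by move=> x y /hT; apply: (scale_mono EL); rewrite le_max lexx.
Qed.

End Extension.
End ProperMetrics.

(** * Values of the asymptotic dimension and the final inequality *)

Section Asdim.
Variables (R : realType) (T : choiceType) (d : T -> T -> R).

Lemma asdim_leP n : asdim_le d n -> (asdim d <= n%:Z%:E)%E.
Proof.
move=> dn; rewrite /asdim; case: pselect => [ex_n|[]]; last first.
  by exists n; exact/asboolP.
by case: ex_minnP => k _ /(_ n); rewrite lee_fin lez_nat; apply; apply/asboolP.
Qed.

Variant asdim_spec : \bar int -> Prop :=
  | AsdimFin n of asdim_le d n : asdim_spec n%:Z%:E
  | AsdimInfty : asdim_spec +oo%E.

Lemma asdimP m : asdim d = m -> asdim_spec m.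
Proof.
move=> <-; rewrite /asdim; case: pselect => [ex_n|_]; last exact: AsdimInfty.
by case: ex_minnP => k /asboolP dk _; exact: AsdimFin.
Qed.

End Asdim.

Theorem theorem5 (R : realType) (Delta Gamma Lambda : groupType)
    (Delta_countable : countable [set: Delta])
    (Gamma_countable : countable [set: Gamma])
    (Lambda_countable : countable [set: Lambda])
    (iota : {multiplicative Delta -> Gamma})
    (pi : {multiplicative Gamma -> Lambda})
    (iota_inj : injective iota)
    (exact_Gamma : range iota = [set g | pi g = 1%g])
    (pi_surj : range pi = [set: Lambda])
    (N : nat -> normal_subgroup Gamma)
    (N_finite_index : forall i, finite_index (N i))
    (N_decr : forall i, N i.+1 `<=` N i)
    (N_separates :
      let q := quotient_map (bigcap_normal N) in
      separates (fun i => q @` N i) (q @` range iota))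
    (dDelta : Delta -> Delta -> R) (dGamma : Gamma -> Gamma -> R)
    (dLambda : Lambda -> Lambda -> R)
    (dDelta_ok : proper_right_invariant_metric dDelta)
    (dGamma_ok : proper_right_invariant_metric dGamma)
    (dLambda_ok : proper_right_invariant_metric dLambda)
    (m n : \bar int) :
  asdim (box_dist dDelta (H := fun i => iota @^-1` N i)) = m ->
  asdim (box_dist dLambda (H := fun i => pi @` N i)) = n ->
  (asdim (box_dist dGamma (H := fun i => N i)) <= m + n)%E.
Proof.
(* Neither value is [-oo], so an infinite one makes the sum [+oo]. *)
move=> /asdimP[{}m dim_m|] /asdimP[{}n dim_n|]; rewrite ?addye ?addey ?leey //.
rewrite -EFinD -PoszD; apply: asdim_leP.
apply: box_coarse_dim_le => //; first exact: normal_is_subgroup.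
apply: (coset_dim_extension exact_Gamma pi_surj N_decr N_separates
  dDelta_ok dGamma_ok dLambda_ok).
  exact: (coarse_dim_le_box dDelta_ok (preimage_is_subgroup iota N) dim_m).
exact: (coarse_dim_le_box dLambda_ok (image_is_subgroup pi N) dim_n).
Qed.
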